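(* Let $n\ge 1$ be an integer, let $f$ be any one of the functionals $\theta^c,\theta^t,\theta^l,\delta^c,\delta^t,\delta^l$ on $\mathcal{K}^n$, and let $K_0\in\mathcal{K}^{n*}$. Then, for every $K\in\mathcal{K}^{n*}$, we have $$f(K)\le(1+\|K,K_0\|^* )^{2n}f(K_0).$$
   Context: An $n$-dimensional convex body is a compact convex subset of Euclidean space $\mathbb{E}^n$ with nonempty interior; $\mathcal{K}^n$ is the family of all of them. $B^n$ is the closed unit ball centered at the origin, $+$ is the Minkowski sum, and $\mathcal{K}^{n*}=\{K\in\mathcal{K}^n:\ B^n\subseteq K\subseteq nB^n\}$. The Hausdorff metric is $\|K_1,K_2\|^*=\min\{r:\ K_1\subseteq K_2+rB^n,\ K_2\subseteq K_1+rB^n\}$. Densities. A packing is a countable family of sets with pairwise disjoint interiors; a covering is a countable family of sets whose union is $\mathbb{E}^n$. For a family $\mathcal{F}$ of copies of $K$, put $D_R(\mathcal{F})=\frac{1}{\mathrm{vol}(RB^n)}\sum_{F\in\mathcal{F},\,F\cap RB^n\ne\emptyset}\mathrm{vol}(F)$. The density of a packing $\mathcal{F}$ is $\limsup_{R\to\infty}D_R(\mathcal{F})$, and the density of a covering $\mathcal{F}$ is $\liminf_{R\to\infty}D_R(\mathcal{F})$. Then $\delta^c(K)$, $\delta^t(K)$, $\delta^l(K)$ are the maximal (supremal) densities of packings by, respectively, congruent copies of $K$ (images under Euclidean isometries), translates of $K$, and lattice translates of $K$ (families $\{K+\mathbf{x}:\mathbf{x}\in\Lambda\}$ with $\Lambda$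 a full-rank lattice). Likewise $\theta^c(K)$, $\theta^t(K)$, $\theta^l(K)$ are the minimal (infimal) densities of coverings of $\mathbb{E}^n$ by, respectively, congruent copies, translates, and lattice translates of $K$. *)

(* Defs.v *)
From mathcomp Require Import all_boot all_order all_algebra.
From mathcomp Require Import all_classical all_reals all_analysis.
Import Order.TTheory GRing.Theory Num.Theory.
Import numFieldNormedType.Exports.

Set Implicit Arguments.
Unset Strict Implicit.
Unset Printing Implicit Defensive.

Local Open Scope classical_set_scope.
Local Open Scope ring_scope.

(* Euclidean n-space is the type 'rV[R]_n of row vectors.  The norm that
   MathComp-Analysis puts on 'rV[R]_n is the sup norm, so the Euclidean norm is
   defined here; both norms induce the same topology, hence the same compact
   sets and interiors. *)
Section euclidean_space.
Context {R : realType} {n : nat}.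
Local Notation E := 'rV[R]_n.
Implicit Types (A B K : set E) (r : R).

Definition enorm (x : E) : R := Num.sqrt (\sum_i x 0 i ^+ 2).

Definition eball r : set E := [set x | enorm x <= r].

Definition minkowski_sum A B : set E := [set x + y | x in A & y in B].

Definition convex_body K : Prop :=
  [/\ compact K, convex_set K & interior K !=set0].

(* The class K^{n*}. *)
Definition convex_body_star K : Prop :=
  [/\ convex_body K, eball 1 `<=` K & K `<=` eball n%:R].

(* The infimum is attained when A and B are nonempty and compact.  The
   condition 0 <= r is there because eball r is empty, and not - r times the
   unit ball, when r < 0. *)
Definition hausdorff_dist A B : R :=
  inf [set r | [/\ 0 <= r, A `<=` minkowski_sum B (eball r)
                         & B `<=` minkowski_sum A (eball r)]].

Definition box (a b : E) : set E :=
  [set x | forall i, a 0 i <= x 0 i <= b 0 i].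

Definition box_cover (a b : nat -> E) A : Prop :=
  (forall k i, a k 0 i <= b k 0 i) /\ A `<=` \bigcup_k box (a k) (b k).

(* n-dimensional Lebesgue measure, as the outer measure given by countable
   covers by boxes; it is only used on images of compact sets under
   isometries, which are measurable. *)
Definition vol A : \bar R :=
  ereal_inf [set v | exists a b, box_cover a b A /\
    v = (\sum_(k <oo) (\prod_i (b k 0 i - a k 0 i))%:E)%E].

Definition euclidean_isometry (g : E -> E) : Prop :=
  forall x y, enorm (g x - g y) = enorm (x - y).

Definition translate (v : E) K : set E := [set x + v | x in K].

(* Full-rank lattices: the integral combinations of the rows of an invertible
   matrix. *)
Definition full_rank_lattice (L : set E) : Prop :=
  exists2 M : 'M[R]_n, M \in unitmx &
    L = [set map_mx intr z *m M | z in [set: 'rV[int]_n]].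

End euclidean_space.

Section densities.
Context {R : realType} {n : nat}.
Local Notation E := 'rV[R]_n.
Implicit Types (K : set E) (F : set (set E)).

Definition packing F : Prop := countable F /\ trivIset F (@interior E).

Definition covering F : Prop := countable F /\ \bigcup_(A in F) A = setT.

(* The quantity D_r(F). *)
Definition ball_density F (r : R) : \bar R :=
  ((\esum_(A in [set A | F A /\ A `&` eball r !=set0]) vol A)
     / vol (@eball R n r))%E.

Definition packing_density F : \bar R :=
  limf_esup (ball_density F) (pinfty_nbhs R).

Definition covering_density F : \bar R :=
  limf_einf (ball_density F) (pinfty_nbhs R).

Definition congruent_copies K F : Prop :=
  forall A, F A -> exists2 g : E -> E, euclidean_isometry g & A = g @` K.

Definition translated_copies K F : Prop :=
  forall A, F A -> exists v, A = translate v K.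

Definition lattice_translates K F : Prop :=
  exists2 L : set E, full_rank_lattice L & F = [set translate v K | v in L].

(* Below, P K F says that F is a family of copies of K of the allowed kind. *)
Definition max_packing_density (P : set E -> set (set E) -> Prop) K : \bar R :=
  ereal_sup [set packing_density F | F in [set F | packing F /\ P K F]].

Definition min_covering_density (P : set E -> set (set E) -> Prop) K : \bar R :=
  ereal_inf [set covering_density F | F in [set F | covering F /\ P K F]].

Definition delta_c : set E -> \bar R := max_packing_density congruent_copies.
Definition delta_t : set E -> \bar R := max_packing_density translated_copies.
Definition delta_l : set E -> \bar R := max_packing_density lattice_translates.
Definition theta_c : set E -> \bar R := min_covering_density congruent_copies.
Definition theta_t : set E -> \bar R := min_covering_density translated_copies.
Definition theta_l : set E -> \bar R := min_covering_density lattice_translates.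

End densities.

(* Main.v *)
Require Import Defs.
From mathcomp Require Import all_boot all_order all_algebra.
From mathcomp Require Import all_classical all_reals all_analysis.
From mathcomp Require Import ring lra.
Import Order.TTheory GRing.Theory Num.Theory.
Import numFieldNormedType.Exports.
Local Open Scope classical_set_scope.
Local Open Scope ring_scope.

(* Put lam = 1 + ||K, K0||*.  Since both bodies are convex and contain the unit
   ball, K is contained in lam K0 and K0 in lam K.  For an isometry g let g' be
   its conjugate x |-> lam g(x / lam).  If the sets g'(K0) cover space, then so
   do the sets g(K); if the sets g(K) have disjoint interiors, then so do the
   sets g'(K0).  In both cases g(K) lies in a translate of lam g'(K0), so its
   volume is at most lam^n vol g'(K0), and if g(K) meets the ball of radius r,
   then g'(K0) meets the ball of radius lam (r + n).  The second factor lam^n is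
   the ratio of the volumes of these two balls, up to a factor ((r + n) / r)^n
   that tends to 1. *)

(** * Euclidean norm and isometries *)

Section euclidean_norm.
Context {R : realType} {n : nat}.
Local Notation E := 'rV[R]_n.
Implicit Types (x y u : E) (A K : set E) (g : E -> E).

Definition dot x y : R := \sum_i x 0 i * y 0 i.

Lemma dotDl x y u : dot (x + y) u = dot x u + dot y u.
Proof. by rewrite -big_split; apply: eq_bigr => i _; rewrite mxE mulrDl. Qed.

Lemma dotC x y : dot x y = dot y x.
Proof. by apply: eq_bigr => i _; rewrite mulrC. Qed.

Lemma dotZl (s : R) x y : dot (s *: x) y = s * dot x y.
Proof. by rewrite mulr_sumr; apply: eq_bigr => i _; rewrite mxE mulrA. Qed.

Lemma dotNl x y : dot (- x) y = - dot x y.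
Proof. by rewrite -scaleN1r dotZl mulN1r. Qed.

Lemma dotxx_ge0 x : 0 <= dot x x.
Proof. by apply: sumr_ge0 => i _; rewrite -expr2 sqr_ge0. Qed.

Lemma enormE x : enorm x = Num.sqrt (dot x x).
Proof. by congr Num.sqrt; apply: eq_bigr => i _; rewrite expr2. Qed.

Lemma enorm_ge0 x : 0 <= enorm x.
Proof. by rewrite enormE sqrtr_ge0. Qed.

Lemma sqr_enorm x : enorm x ^+ 2 = dot x x.
Proof. by rewrite enormE sqr_sqrtr ?dotxx_ge0. Qed.

Lemma enorm0 : enorm (0 : E) = 0.
Proof. by rewrite enormE -(scale0r 0) dotZl mul0r sqrtr0. Qed.

Lemma enormZ (s : R) x : enorm (s *: x) = `|s| * enorm x.
Proof.
by rewrite !enormE dotZl dotC dotZl mulrA -expr2 sqrtrM ?sqr_ge0// sqrtr_sqr.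
Qed.

Lemma coord_le_enorm x i : `|x 0 i| <= enorm x.
Proof.
rewrite -sqrtr_sqr ler_wsqrtr// (bigD1 i)//= lerDl.
by apply: sumr_ge0 => j _; exact: sqr_ge0.
Qed.

Lemma enorm_eq0 x : enorm x = 0 -> x = 0.
Proof.
move=> x0; apply/rowP => i; apply/eqP.
by rewrite mxE -normr_le0 -x0 coord_le_enorm.
Qed.

(** Cauchy-Schwarz: for nonzero norms, expand the squared length of [enorm y *: x - enorm x *: y],
    which is nonnegative, and cancel the factor [enorm x * enorm y]. *)
Lemma dot_le_enorm x y : dot x y <= enorm x * enorm y.
Proof.
have [x0|x0] := eqVneq (enorm x) 0.
  by rewrite x0 mul0r (enorm_eq0 _ x0) -(scale0r 0) dotZl mul0r.
have [y0|y0] := eqVneq (enorm y) 0.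
  by rewrite y0 mulr0 (enorm_eq0 _ y0) dotC -(scale0r 0) dotZl mul0r.
have xy0 : 0 < enorm x * enorm y.
  by rewrite lt_def mulf_neq0//= mulr_ge0 ?enorm_ge0.
have := dotxx_ge0 (enorm y *: x - enorm x *: y).
rewrite dotDl dotNl !dotZl !(dotC _ (_ - _)) !dotDl !dotNl !dotZl -!sqr_enorm.
rewrite (dotC y x) => h.
have : 0 <= (enorm x * enorm y) * (enorm x * enorm y - dot x y) by nra.
by rewrite pmulr_rge0// subr_ge0.
Qed.

Lemma enormD x y : enorm (x + y) <= enorm x + enorm y.
Proof.
rewrite -(@ler_pXn2r _ 2) ?nnegrE ?addr_ge0 ?enorm_ge0//.
rewrite sqr_enorm dotDl !(dotC _ (_ + _)) !dotDl -!sqr_enorm (dotC y x).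
by have := dot_le_enorm x y; nra.
Qed.

(** The sup-norm ball of radius [e / n.+1%:R] fits inside: [n] squares of its radius add up to at
    most [e ^+ 2]. The successor keeps the divisor nonzero. *)
Lemma enorm_nbhs x (e : R) : 0 < e -> nbhs x [set y | enorm (y - x) <= e].
Proof.
move=> e0; have d0 : 0 < e / n.+1%:R by rewrite divr_gt0.
apply/nbhs_ballP; exists (e / n.+1%:R) => // y [_ xy] /=.
rewrite -(ler_pXn2r (ltn0Sn 1)) ?nnegrE ?enorm_ge0 ?(ltW e0)//.
rewrite sqr_enorm (@le_trans _ _ (\sum_(i < n) (e / n.+1%:R) ^+ 2))//.
  apply: ler_sum => i _; rewrite -expr2 -real_normK ?num_real//.
  rewrite ler_pXn2r ?nnegrE ?(ltW d0)// !mxE.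
  by have := xy 0 i; rewrite /ball/= distrC => /ltW.
rewrite sumr_const card_ord expr_div_n -[leLHS]mulr_natr -mulrA.
rewrite ger_pMr ?exprn_gt0//.
rewrite mulrC ler_pdivrMr ?exprn_gt0// mul1r -natrX ler_nat.
by rewrite (leq_trans (leqnSn n))// leq_pmulr.
Qed.

(* The recentred map preserves the dot product; the rows of M are the images of
   the standard basis, hence orthonormal. *)
Lemma isometryE g : euclidean_isometry g ->
  exists2 M : 'M[R]_n, M *m M^T = 1%:M & forall x, g x = g 0 + x *m M.
Proof.
move=> hg; have [h hE] : exists h : E -> E, forall x, h x = g x - g 0.
  by exists (fun x => g x - g 0).
have hn x : dot (h x) (h x) = dot x x.
  by rewrite -!sqr_enorm hE hg subr0.
have hB x y : dot (h x - h y) (h x - h y) = dot (x - y) (x - y).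
  rewrite -!sqr_enorm -(hg x y); congr (enorm _ ^+ 2).
  by rewrite !hE opprB addrA subrK.
have hd x y : dot (h x) (h y) = dot x y.
  have := hB x y.
  rewrite !(dotDl, dotNl) !(dotC _ (_ - _)) !(dotDl, dotNl) !hn.
  by rewrite (dotC (h y)) (dotC y); lra.
have dote x i : dot x (delta_mx 0 i) = x 0 i.
  rewrite /dot (bigD1 i)//= big1 => [|j /negbTE ji]; rewrite mxE !eqxx.
    by rewrite mulr1 addr0.
  by rewrite ji mulr0.
pose M : 'M[R]_n := \matrix_i h (delta_mx 0 i).
have hM x : h x *m M^T = x.
  apply/rowP => i; rewrite mxE -[RHS]dote -hd.
  by apply: eq_bigr => j _; rewrite !mxE.
have MM : M *m M^T = 1%:M.
  by apply/row_matrixP => i; rewrite row_mul rowK hM row1.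
(* Linearity of [h] follows from orthogonality: [M^T *m M = 1%:M] turns [h x *m M^T = x] into
   [h x = x *m M]. *)
exists M => // x; rewrite -[x in RHS]hM -mulmxA (mulmx1C MM) mulmx1.
by rewrite hE addrC subrK.
Qed.

Lemma isometry_surj g y : euclidean_isometry g -> exists x, g x = y.
Proof.
move=> /isometryE[M MM gE]; exists ((y - g 0) *m M^T).
by rewrite gE -mulmxA (mulmx1C MM) mulmx1 addrC subrK.
Qed.

(* A body equal to its translate by v - w contains an unbounded progression
   unless v = w. *)
Lemma translate_inj K v w (m : R) : K !=set0 -> K `<=` eball m ->
  translate v K = translate w K -> v = w.
Proof.
move=> [x Kx] Km vw.
have step y : K y -> K (y + (v - w)).
  move=> Ky; have : translate w K (y + v) by rewrite -vw; exists y.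
  by move=> [z Kz /(canRL (addrK w)) zE]; rewrite addrA -zE.
have iter k : K (x + (v - w) *+ k).
  by elim: k => [|k IH]; rewrite ?mulr0n ?addr0// mulrSr addrA; exact: step.
apply/eqP; rewrite -subr_eq0; apply/eqP/rowP => i; rewrite [RHS]mxE.
apply/eqP; apply: contraT => u0; set u := v - w in u0 iter.
have m0 : 0 <= m by rewrite (le_trans _ (Km _ Kx))// enorm_ge0.
(* Points of [eball m] differ by at most [m + m] in each coordinate; [k] steps along [u] exceed this
   in coordinate [i]. *)
pose k := Num.bound ((m + m) / `|u 0 i|).
have : (m + m) / `|u 0 i| < k%:R.
  by rewrite archi_boundP// divr_ge0// addr_ge0.
rewrite ltr_pdivrMr ?normr_gt0// ltNge => /negP[].
have ux : `|x 0 i + u 0 i *+ k| <= m.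
  have := Km _ (iter k); apply: le_trans.
  by rewrite (le_trans _ (coord_le_enorm _ i))// !(mxE, mulmxnE).
have x0 : `|x 0 i| <= m by apply: le_trans (Km _ Kx); exact: coord_le_enorm.
rewrite -normr_nat -normrM mulr_natl -[X in `|X|](addrK (x 0 i)) addrC.
by rewrite (le_trans (ler_normD _ _))// lerD ?normrN// addrC.
Qed.

End euclidean_norm.

(** * Volume *)

Section volume.
Context {R : realType} {n : nat}.
Local Notation E := 'rV[R]_n.
Implicit Types (A : set E) (v : E) (s r : R).

Lemma vol_ge0 A : (0 <= vol A)%E.
Proof.
apply: le_ereal_inf_tmp => _ [a [b [[ab _] ->]]]; apply: nneseries_ge0 => k _ _.
by rewrite lee_fin prodr_ge0// => i _; rewrite subr_ge0.
Qed.

Lemma le_vol A B : A `<=` B -> (vol A <= vol B)%E.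
Proof.
move=> AB; apply: ereal_inf_le_tmp => _ [a [b [[ab Bab] ->]]].
by exists a, b; split=> //; split=> // x /AB /Bab.
Qed.

(** A homothety carries a box cover of [A] to a box cover of the image and multiplies each box
    volume by [s ^+ n]. *)
Lemma vol_homothety s v A : 0 < s ->
  (vol [set (s *: x + v)%R | x in A] <= (s ^+ n)%:E * vol A)%E.
Proof.
move=> s0; rewrite -ereal_inf_pZl ?exprn_gt0//.
apply: le_ereal_inf_tmp => _ [_ [a [b [[ab Aab] ->]]] <-].
apply: ereal_inf_lbound.
exists (fun k => s *: a k + v), (fun k => s *: b k + v); split.
  split=> [k i|_ [x /Aab[k _ xk] <-]].
    by rewrite !mxE lerD2r ler_pM2l.
  by exists k => // i; rewrite !mxE !lerD2r !ler_pM2l.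
rewrite -nneseriesZl => [|k _]; last first.
  by rewrite lee_fin prodr_ge0// => i _; rewrite subr_ge0.
apply: eq_eseriesr => k _; rewrite -EFinM; congr EFin.
rewrite -[in s ^+ n](card_ord n) -prodr_const -big_split/=.
by apply: eq_bigr => i _; rewrite !mxE; ring.
Qed.

(** The summand [0] matches the shape of the image in [vol_homothety]. *)
Lemma eball_scale s r : 0 < s ->
  eball (s * r) = [set s *: x + 0 | x in @eball R n r].
Proof.
move=> s0; apply/seteqP; split=> [x xs|_ [x xr <-]].
  exists (s^-1 *: x); last by rewrite addr0 scalerA divff ?gt_eqF// scale1r.
  by rewrite /eball/= enormZ gtr0_norm ?invr_gt0// ler_pdivrMl.
by rewrite /eball/= addr0 enormZ gtr0_norm// ler_pM2l.
Qed.

Lemma vol_eball_scale s r : 0 < s ->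
  vol (@eball R n (s * r)) = ((s ^+ n)%:E * vol (@eball R n r))%E.
Proof.
move=> s0; apply/eqP; rewrite eq_le {1}eball_scale// vol_homothety//=.
have sn0 : 0 < s ^+ n by rewrite exprn_gt0.
(* The reverse inequality is [vol_homothety] for the inverse ratio, applied to the ball of radius
   [s * r]. *)
rewrite -(@lee_pmul2l _ (s^-1 ^+ n)%:E)// ?lte_fin ?exprn_gt0 ?invr_gt0//.
rewrite muleA -EFinM -exprMn mulVf ?gt_eqF// expr1n mul1e.
rewrite -{1}(mulKf (lt0r_neq0 s0) r) (eball_scale _ (s * r)) ?invr_gt0//.
by rewrite vol_homothety ?invr_gt0.
Qed.

End volume.

(** * Comparison of densities *)

Section limsup_liminf.
Context {R : realType} (D1 D2 : R -> \bar R) (a m kappa : R).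
Hypotheses (D1_ge0 : forall r, (0 <= D1 r)%E).
Hypotheses (a_gt0 : 0 < a) (kappa_gt0 : 0 < kappa).
Hypothesis D12 : forall c, 0 < c < 1 -> exists M, forall r, M < r ->
  (c%:E * D1 r <= kappa%:E * D2 (a * (r + m)))%E.

(** The inequality is proved up to each factor [c] in (0, 1), which [lee_mul01Pr] then removes;
    [r |-> a * (r + m)] maps a neighbourhood of infinity into any given one. *)
Lemma limf_esup_pinfty_le :
  (limf_esup D1 (pinfty_nbhs R) <= kappa%:E * limf_esup D2 (pinfty_nbhs R))%E.
Proof.
apply/lee_mul01Pr => [|c c01].
  rewrite limf_esupE; apply: le_ereal_inf_tmp => _ [V [M [_ MV]] <-].
  rewrite (le_trans (D1_ge0 (M + 1)))//; apply: ereal_sup_ubound.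
  by exists (M + 1) => //; apply: MV; rewrite ltrDl.
have [M hM] := D12 c c01; have /andP[c0 _] := c01.
rewrite !limf_esupE -(ereal_inf_pZl _ kappa_gt0).
apply: le_ereal_inf_tmp => _ [_ [V [N [_ NV]] <-] <-].
pose W := [set r | Num.max M (N / a - m) < r].
rewrite (@le_trans _ _ (c%:E * ereal_sup (D1 @` W))%E)//.
  rewrite lee_pmul2l ?lte_fin//; apply: ereal_inf_lbound; exists W => //.
  by exists (Num.max M (N / a - m)); split => //; exact: num_real.
rewrite -(ereal_sup_pZl _ c0); apply: ge_ereal_sup => _ [_ [r + <-] <-].
rewrite /W/= gt_max => /andP[Mr Nr].
rewrite (le_trans (hM _ Mr))// lee_pmul2l ?lte_fin//; apply: ereal_sup_ubound.
by exists (a * (r + m)) => //; apply: NV; rewrite mulrC -ltr_pdivrMr// -ltrBlDr.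
Qed.

Lemma limf_einf_pinfty_le :
  (limf_einf D1 (pinfty_nbhs R) <= kappa%:E * limf_einf D2 (pinfty_nbhs R))%E.
Proof.
apply/lee_mul01Pr => [|c c01].
  rewrite limf_einfE; apply: le_ereal_sup_tmp.
  exists (ereal_inf (D1 @` setT)).
    by exists setT => //; exact: filterT.
  by apply: le_ereal_inf_tmp => _ [r _ <-].
have [M hM] := D12 c c01; have /andP[c0 _] := c01.
rewrite !limf_einfE -(ereal_sup_pZl _ c0).
apply: ge_ereal_sup => _ [_ [V [N [_ NV]] <-] <-].
(* For the lower limit the substitution is inverted: [t] in [W] is [a * (r + m)] with
   [r = t / a - m] beyond both [M] and [N]. *)
pose W := [set t | a * (Num.max M N + m) < t].
rewrite (@le_trans _ _ (kappa%:E * ereal_inf (D2 @` W))%E)//; last first.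
  rewrite lee_pmul2l ?lte_fin//; apply: ereal_sup_ubound; exists W => //.
  by exists (a * (Num.max M N + m)); split => //; exact: num_real.
rewrite -(ereal_inf_pZl _ kappa_gt0).
apply: le_ereal_inf_tmp => _ [_ [t + <-] <-].
rewrite /W/= mulrC -ltr_pdivlMr// -ltrBrDr gt_max => /andP[Mt Nt].
have -> : t = a * (t / a - m + m) by rewrite subrK mulrC divfK// gt_eqF.
apply: le_trans (hM _ Mt); rewrite lee_pmul2l ?lte_fin//.
by apply: ereal_inf_lbound; exists (t / a - m) => //; exact: NV.
Qed.

End limsup_liminf.

Section density_comparison.
Context {R : realType} {n : nat}.
Local Notation E := 'rV[R]_n.
Variables (F1 F2 : set (set E)) (psi : set E -> set E) (lam m : R).
Hypotheses (lam_gt0 : 0 < lam) (m_ge0 : 0 <= m).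
Hypotheses (psi_inj : set_inj F1 psi) (psiF : forall A, F1 A -> F2 (psi A)).
Hypothesis vol_psi : forall A, F1 A -> (vol A <= (lam ^+ n)%:E * vol (psi A))%E.
Hypothesis psi_meets : forall A r, F1 A -> A `&` eball r !=set0 ->
  psi A `&` eball (lam * (r + m)) !=set0.

Lemma ball_density_ge0 (F : set (set E)) r : (0 <= ball_density F r)%E.
Proof.
by apply: mule_ge0; [apply: esum_ge0 => A _|rewrite inve_ge0]; exact: vol_ge0.
Qed.

Lemma esumZl_le (T : choiceType) (S : set T) (c : R) (f : T -> \bar R) :
  0 < c -> (forall x, 0 <= f x)%E ->
  (\esum_(x in S) (c%:E * f x) <= c%:E * \esum_(x in S) f x)%E.
Proof.
move=> c0 f0; apply: ge_ereal_sup => _ [X XS <-].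
rewrite -ge0_mule_fsumr ?lee_pmul2l ?lte_fin//.
by apply: ereal_sup_ubound; exists X.
Qed.

(* The volume of the unit ball need not be known to be positive or finite:
   inversion in \bar R is multiplicative against a positive real factor even
   when the other factor is 0 or +oo. *)
Lemma ball_density_le r : 0 < r ->
  (ball_density F1 r <=
   (lam ^+ (2 * n) * ((r + m) / r) ^+ n)%:E *
     ball_density F2 (lam * (r + m)))%E.
Proof.
move=> r0; have rm : 0 < r + m by rewrite ltr_pwDl.
set s := lam * ((r + m) / r); have s0 : 0 < s by rewrite mulr_gt0 ?divr_gt0.
have hs : lam * (r + m) = s * r by rewrite /s -!mulrA mulVf ?mulr1 ?gt_eqF.
rewrite hs; have sn0 : 0 < s ^+ n by rewrite exprn_gt0.
rewrite /ball_density vol_eball_scale//.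
set S1 := esum _ _; set S2 := esum _ _; set V := vol _.
have V0 : (0 <= V)%E by exact: vol_ge0.
have S12 : (S1 <= (lam ^+ n)%:E * S2)%E.
  rewrite /S1; set T1 := [set A | _]; set T2 := [set A | _] in S2 *.
  have injT : set_inj T1 psi.
    by move=> A B /set_mem[FA _] /set_mem[FB _]; apply: psi_inj; rewrite inE.
  apply: (@le_trans _ _ (\esum_(A in T1) ((lam ^+ n)%:E * vol (psi A)))%E).
    by apply: le_esum => A [FA _]; exact: vol_psi.
  have lamn0 : 0 < lam ^+ n by rewrite exprn_gt0.
  apply: (le_trans (esumZl_le _ _ _ _ lamn0 (fun A => vol_ge0 (psi A)))).
  (* By injectivity the sum is one over the image of [T1], which is contained in [T2]. *)
  rewrite lee_pmul2l ?lte_fin ?exprn_gt0// -(esum_image T1 psi)//.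
  apply: ereal_sup_le => _ [X [finX XT] <-]; exists X => //.
  split=> // _ /XT[A [FA Ar] <-].
  by split; [exact: psiF|rewrite -hs; exact: psi_meets].
have -> : ((s ^+ n)%:E * V)^-1%E = ((s ^+ n)^-1%:E * V^-1)%E.
  rewrite inveM ?inver ?gt_eqF//.
  case: V V0 => [v||] //; rewrite /inveM_def /= gt_eqF//= lee_fin => _.
  by rewrite (ltW sn0) implybT.
rewrite (le_trans (lee_wpmul2r _ S12)) ?inve_ge0//.
rewrite [(S2 * (_ * _))%E]muleCA [leRHS]muleA -EFinM -muleA le_eqVlt.
apply/orP; left; apply/eqP; congr (_%:E * _)%E.
by rewrite mul2n -addnn exprD -mulrA -exprMn mulfK// gt_eqF.
Qed.

(** Bernoulli's inequality bounds [(r / (r + m)) ^+ n] below by [1 - n%:R * (m / (r + m))], which is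
    at least [c] once [r] exceeds [n%:R * m / (1 - c)]. *)
Lemma eventually_ratio_le1 c : 0 < c < 1 ->
  exists M, forall r, M < r -> 0 < r /\ c * ((r + m) / r) ^+ n <= 1.
Proof.
move=> /andP[c0 c1]; exists (n%:R * m / (1 - c)) => r Mr.
have r0 : 0 < r.
  by apply: le_lt_trans Mr; rewrite divr_ge0 ?mulr_ge0// subr_ge0 ltW.
split=> //; have rm : 0 < r + m by rewrite ltr_pwDl.
have bernoulli k : 1 - k%:R * (m / (r + m)) <= (r / (r + m)) ^+ k.
  have t0 : 0 <= m / (r + m) by rewrite divr_ge0// ltW.
  have -> : r / (r + m) = 1 - m / (r + m) by field; rewrite gt_eqF.
  have t1 : m / (r + m) <= 1 by rewrite ler_pdivrMr// mul1r lerDr ltW.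
  elim: k => [|k IH]; first by rewrite mul0r subr0 expr0.
  rewrite exprS -natr1; have k0 : (0 : R) <= k%:R by [].
  set t := m / _ in t0 t1 IH *.
  have := ler_wpM2l (_ : 0 <= 1 - t) IH; rewrite subr_ge0 => /(_ t1).
  by apply: le_trans; nra.
have -> : (r + m) / r = (r / (r + m))^-1 by rewrite invf_div.
rewrite exprVn ler_pdivrMr ?exprn_gt0 ?divr_gt0// mul1r.
apply: le_trans (bernoulli n); rewrite lerBrDl -lerBrDr mulrA ler_pdivrMr//.
move: Mr; rewrite ltr_pdivrMr ?subr_gt0// => Mr.
by rewrite (le_trans (ltW Mr))// mulrC ler_pM2l ?subr_gt0// lerDl.
Qed.

Lemma densities_le :
  (packing_density F1 <= (lam ^+ (2 * n))%:E * packing_density F2)%E /\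
  (covering_density F1 <= (lam ^+ (2 * n))%:E * covering_density F2)%E.
Proof.
have l0 : 0 < lam ^+ (2 * n) by rewrite exprn_gt0.
have D12 c : 0 < c < 1 -> exists M, forall r, M < r ->
    (c%:E * ball_density F1 r <=
     (lam ^+ (2 * n))%:E * ball_density F2 (lam * (r + m)))%E.
  move=> c01; have [M hM] := eventually_ratio_le1 _ c01.
  exists M => r /hM[r0 rc]; have /andP[c0 _] := c01.
  rewrite (@le_trans _ _ (c%:E * ((lam ^+ (2 * n) * ((r + m) / r) ^+ n)%:E *
     ball_density F2 (lam * (r + m)))))%E//.
    by rewrite lee_pmul2l ?lte_fin ?ball_density_le.
  rewrite muleA -EFinM lee_wpmul2r ?ball_density_ge0// lee_fin.
  by rewrite mulrCA ger_pMr.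
have D1_ge0 := ball_density_ge0 F1; split.
  exact: limf_esup_pinfty_le D1_ge0 lam_gt0 l0 D12.
exact: limf_einf_pinfty_le D1_ge0 lam_gt0 l0 D12.
Qed.

End density_comparison.

(** * Rescaled families *)

Section rescaling.
Context {R : realType} {n : nat}.
Local Notation E := 'rV[R]_n.
Implicit Types (x y v : E) (A K : set E) (g : E -> E) (F : set (set E)).
Implicit Types (s r : R).

(** For [s != 0], conjugating an isometry by the homothety of ratio [s] keeps its linear part and
    multiplies its translation part by [s]. *)
Definition rescaled s g : E -> E := fun x => s *: g (s^-1 *: x).

Lemma rescaled_isometry s g : 0 < s ->
  euclidean_isometry g -> euclidean_isometry (rescaled s g).
Proof.
move=> s0 hg x y; rewrite /rescaled -scalerBr enormZ hg -scalerBr enormZ mulrA.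
by rewrite -normrM divff ?gt_eqF// normr1 mul1r.
Qed.

Lemma rescaledK s g : s != 0 -> rescaled s (rescaled s^-1 g) = g.
Proof.
move=> s0; apply/funext => x; rewrite /rescaled invrK !scalerA divff//.
by rewrite !scale1r.
Qed.

Lemma rescaled_shift s v : s != 0 ->
  rescaled s (fun x => x + v) = (fun x => x + s *: v).
Proof.
move=> s0; apply/funext => x.
by rewrite /rescaled scalerDr scalerA divff// scale1r.
Qed.

Variables (K1 K2 : set E) (lam m : R).
Hypothesis (lam_gt0 : 0 < lam).
Hypotheses (K10 : K1 0) (K20 : K2 0) (K1m : K1 `<=` eball m).
Hypothesis K12 : forall x, K1 x -> K2 (lam^-1 *: x).

Lemma vol_rescaled_image g : euclidean_isometry g ->
  (vol (g @` K1) <= (lam ^+ n)%:E * vol (rescaled lam g @` K2))%E.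
Proof.
move=> /isometryE[M _ gE].
(* The vector corrects the translation part: [lam *: rescaled lam g (lam^-1 *: x)] is [g x] with
   [g 0] replaced by [lam ^+ 2 *: g 0]. *)
apply: le_trans (vol_homothety lam (g 0 - lam ^+ 2 *: g 0) _ lam_gt0).
apply: le_vol => _ [x K1x <-]; exists (rescaled lam g (lam^-1 *: x)).
  by exists (lam^-1 *: x) => //; exact: K12.
rewrite /rescaled gE [g x]gE !scalerDr -!scalemxAl !scalerA -expr2.
have -> : lam ^+ 2 / lam / lam = 1 by field; rewrite gt_eqF.
by rewrite scale1r addrC addrA subrK.
Qed.

Lemma rescaled_image_meets g r : euclidean_isometry g ->
  g @` K1 `&` eball r !=set0 ->
  rescaled lam g @` K2 `&` eball (lam * (r + m)) !=set0.
Proof.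
(* The image of the origin is a common point: [g 0] is within [m] of [g x], and [g x] is within [r]
   of the origin. *)
move=> hg [_ [[x K1x <-] gxr]]; exists (rescaled lam g 0).
split; first by exists 0.
rewrite /eball/= /rescaled scaler0 enormZ gtr0_norm// ler_pM2l//.
rewrite -(subrK (g x) (g 0)) (le_trans (enormD _ _))// addrC lerD//.
by rewrite hg sub0r -scaleN1r enormZ normrN1 mul1r; exact: K1m.
Qed.

(** [psi] is left abstract because packings use the rescaling itself, and coverings a choice of
    preimages under it. *)
Lemma rescaled_densities_le F1 F2 (psi : set E -> set E) :
  set_inj F1 psi -> (forall A, F1 A -> F2 (psi A)) ->
  (forall A, F1 A -> exists2 g, euclidean_isometry g &
     A = g @` K1 /\ psi A = rescaled lam g @` K2) ->
  (packing_density F1 <= (lam ^+ (2 * n))%:E * packing_density F2)%E /\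
  (covering_density F1 <= (lam ^+ (2 * n))%:E * covering_density F2)%E.
Proof.
move=> psi_inj psiF hpsi; apply: (@densities_le _ _ _ _ psi _ m) => //.
- by rewrite (le_trans (enorm_ge0 _) (K1m _ K10)).
- by move=> A /hpsi[g hg [-> ->]]; exact: vol_rescaled_image.
- by move=> A r /hpsi[g hg [-> ->]]; exact: rescaled_image_meets.
Qed.

(** To cover [y], take the member of [F] through [lam *: y] and shrink: the scaled preimage lies in
    [K1]. *)
Lemma rescaled_covering F (g : set E -> E -> E) :
  (forall x, K2 x -> K1 (lam^-1 *: x)) -> covering F ->
  (forall A, F A -> euclidean_isometry (g A) /\ A = g A @` K2) ->
  let F' := [set rescaled lam^-1 (g A) @` K1 | A in F] in
  covering F' /\
  (covering_density F' <= (lam ^+ (2 * n))%:E * covering_density F)%E.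
Proof.
move=> K21 [cF FT] hg F'; split; first split.
- exact: card_le_trans (card_image_le _ _) cF.
- apply/seteqP; split=> // y _.
  have [A FA] : (\bigcup_(A in F) A) (lam *: y) by rewrite FT.
  have [_ AE] := hg A FA; rewrite {1}AE => -[x K2x gx].
  exists (rescaled lam^-1 (g A) @` K1); first by exists A.
  exists (lam^-1 *: x); first exact: K21.
  rewrite /rescaled invrK !scalerA divff ?gt_eqF// scale1r gx scalerA.
  by rewrite mulVf ?gt_eqF// scale1r.
(* Distinct members of [F] may give the same rescaled set, so one is chosen for each; as a right
   inverse, [psi] is injective. *)
have /choice[psi hpsi] : forall B, exists A, F' B ->
    F A /\ rescaled lam^-1 (g A) @` K1 = B.
  move=> B; have [[A FA AB]|nB] := pselect (F' B); first by exists A.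
  by exists set0 => /nB.
apply: (proj2 (A := _)); apply: (rescaled_densities_le _ _ psi) =>
  [A B /set_mem F'A /set_mem F'B AB|B /hpsi[]//|B /hpsi[FB BE]].
  by rewrite -(hpsi _ F'A).2 -(hpsi _ F'B).2 AB.
have [gi gE] := hg _ FB; exists (rescaled lam^-1 (g (psi B))).
  by apply: rescaled_isometry; rewrite ?invr_gt0.
by rewrite BE rescaledK ?gt_eqF.
Qed.

(** Shrinking a rescaled copy of [K2] by [lam] lands inside the original copy of [K1], so
    overlapping interiors would already overlap in [F]. *)
Lemma rescaled_packing F (g : set E -> E -> E) :
  (forall x, K2 x -> K1 (lam^-1 *: x)) -> eball 1 `<=` K2 -> packing F ->
  (forall A, F A -> euclidean_isometry (g A) /\ A = g A @` K1) ->
  let F' := [set rescaled lam (g A) @` K2 | A in F] in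
  packing F' /\
  (packing_density F <= (lam ^+ (2 * n))%:E * packing_density F')%E.
Proof.
move=> K21 ballK2 [cF tF] hg F'.
have int_scale A x : F A -> interior (rescaled lam (g A) @` K2) x ->
    interior A (lam^-1 *: x).
  move=> FA xA.
  have lamA : nbhs (lam^-1 *: x)
      [set y | (rescaled lam (g A) @` K2) (lam *: y)].
    apply: (@scaler_continuous R E lam (lam^-1 *: x)).
    by rewrite scalerA divff ?gt_eqF// scale1r.
  apply: (@filterS E (nbhs (lam^-1 *: x)) _ _ _ _ lamA) => y [z K2z].
  move=> /(scalerI (lt0r_neq0 lam_gt0)) <-.
  suff : (g A @` K1) (g A (lam^-1 *: z)) by rewrite -(hg A FA).2.
  by exists (lam^-1 *: z) => //; exact: K21.
have disj A B : F A -> F B -> interior (rescaled lam (g A) @` K2) `&`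
    interior (rescaled lam (g B) @` K2) !=set0 -> A = B.
  move=> FA FB [x [xA xB]]; apply: tF => //; exists (lam^-1 *: x).
  by split; exact: int_scale.
(* Nonempty interiors make the rescaling injective on [F]: two members with the same rescaled set
   would have overlapping interiors. The unit ball around the image of the origin supplies one. *)
have int_neq0 A : F A -> interior (rescaled lam (g A) @` K2) !=set0.
  move=> FA; exists (rescaled lam (g A) 0).
  have iso := rescaled_isometry _ _ lam_gt0 (hg A FA).1.
  apply: filterS (enorm_nbhs _ _ ltr01) => y /=.
  have [x <-] := isometry_surj _ y iso; rewrite iso subr0 => x1.
  by exists x => //; exact: ballK2.
split; first split.
- exact: card_le_trans (card_image_le _ _) cF.
- by move=> _ _ [A FA <-] [B FB <-] AB; rewrite (disj A B FA FB AB).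
apply: (proj1 (B := _)); apply: (rescaled_densities_le _ _
  (fun A => rescaled lam (g A) @` K2)) =>
  [A B /set_mem FA /set_mem FB AB|A FA|A FA].
- by apply: disj => //; rewrite -AB setIid; exact: int_neq0.
- by exists A.
- by have [gi gE] := hg A FA; exists (g A).
Qed.

End rescaling.

(** * Hausdorff distance and mutual inclusion after scaling *)

Section hausdorff.
Context {R : realType} {n : nat}.
Local Notation E := 'rV[R]_n.
Implicit Types (K L : set E) (r : R).

Lemma hausdorff_distC K L : hausdorff_dist K L = hausdorff_dist L K.
Proof. by congr inf; apply/seteqP; split=> r [r0 KL LK]; split. Qed.

Lemma star0 K : convex_body_star K -> K 0.
Proof. by case=> _ B1 _; apply: B1; rewrite /eball/= enorm0. Qed.

(** [(k + y) / (1 + r)] is the convex combination of [k] and [y / r] with weights [1 / (1 + r)] and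
    [r / (1 + r)], and [y / r] lies in the unit ball. *)
Lemma sum_eball_scaled K r x : convex_set K -> eball 1 `<=` K -> 0 < r ->
  minkowski_sum K (eball r) x -> K ((1 + r)^-1 *: x).
Proof.
move=> cK BK r0 [k Kk [y yr <-]].
have r1 : 0 < 1 + r by rewrite addr_gt0.
have Ky : K (r^-1 *: y).
  apply: BK; rewrite /eball/= enormZ gtr0_norm ?invr_gt0//.
  by rewrite ler_pdivrMl ?mulr1.
have t01 : 0 <= (1 + r)^-1 <= 1.
  by rewrite invr_ge0 ltW//= invf_le1// lerDl ltW.
have := cK k (r^-1 *: y) (Itv01 (proj1 (andP t01)) (proj2 (andP t01))).
rewrite !inE => /(_ Kk Ky); rewrite /conv/= scalerDr scalerA.
congr (K (_ + _ *: _)).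
by rewrite /unstable.onem; field; rewrite !gt_eqF.
Qed.

Lemma hausdorff_dist_ge0 K L : 0 <= hausdorff_dist K L.
Proof. rewrite /hausdorff_dist; set S := (S in inf S).
have [->|/set0P S0] := eqVneq S set0; first by rewrite inf0.
by apply: lb_le_inf => // r []. Qed.

(** The inclusion is obtained for [d + e] with every [e > 0], and passes to the limit as [e] tends
    to 0 because [L] is closed. *)
Lemma hausdorff_dist_scaled K L x : convex_body_star K -> convex_body_star L ->
  K x -> L ((1 + hausdorff_dist K L)^-1 *: x).
Proof.
move=> hK hL Kx; have [_ _ Kn] := hK; have [[cptL cL _] BL Ln] := hL.
set d := hausdorff_dist K L; have d0 : 0 <= d by exact: hausdorff_dist_ge0.
have inS : has_inf [set r | [/\ 0 <= r, K `<=` minkowski_sum L (eball r)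
                         & L `<=` minkowski_sum K (eball r)]].
  split; last by exists 0 => r [].
  (* The radius [n] is admissible: both bodies contain the origin and lie in [eball n%:R]. *)
  exists n%:R; split=> // y Ky; exists 0; rewrite ?add0r; do ?exact: star0.
    by exists y; [exact: Kn|rewrite add0r].
  by exists y; [exact: Ln|rewrite add0r].
have near_d e : 0 < e -> L ((1 + (d + e))^-1 *: x).
  move=> e0; apply: sum_eball_scaled => //; first by rewrite ltr_wpDl.
  have [r [r0 KL _] rd] := inf_adherent e0 inS.
  have [k Lk [y yr <-]] := KL _ Kx; exists k => //; exists y => //.
  by rewrite /eball/=; apply: le_trans yr _; exact: ltW.
have L_closed : closed L by apply: compact_closed cptL; exact: norm_hausdorff.
apply: (@closed_cvg _ _ _ (at_right_proper_filter (0 : R))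
  (fun e => (1 + (d + e))^-1 *: x) _ L_closed).
  by near=> e; apply: near_d; near: e; exact: nbhs_right_gt.
apply: cvg_at_right_filter; apply: cvgZ; last exact: cvg_cst.
have d1 : 1 + d != 0 by rewrite gt_eqF// ltr_pwDl.
apply: cvgV => //; apply: cvgD; first exact: cvg_cst.
rewrite -[X in _ --> X]addr0; apply: cvgD; first exact: cvg_cst.
exact: cvg_id.
Unshelve. all: by end_near. Qed.

End hausdorff.

(** * Congruent, translated and lattice families under rescaling *)

Section admissible_families.
Context {R : realType} {n : nat}.
Local Notation E := 'rV[R]_n.
Implicit Types (K L : set E) (F : set (set E)) (s m : R).
Implicit Types (P : set E -> set (set E) -> Prop).

(* The maps g exhibit the members of F as copies of K; rescaling these maps
   turns F into an admissible family of copies of any other body. *)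
Definition rescalable P := forall K F m, K !=set0 -> K `<=` eball m -> P K F ->
  exists2 g : set E -> E -> E,
    forall A, F A -> euclidean_isometry (g A) /\ A = g A @` K &
    forall L s, 0 < s -> P L [set rescaled s (g A) @` L | A in F].

Lemma rescalable_congruent : rescalable congruent_copies.
Proof.
move=> K F m _ _ PF; have /choice[g hg] : forall A, exists g : E -> E,
    F A -> euclidean_isometry g /\ A = g @` K.
  move=> A; have [FA|nF] := pselect (F A); last by exists id => /nF.
  by have [g gi AE] := PF A FA; exists g.
exists g => // L s s0 _ [A FA <-]; exists (rescaled s (g A)) => //.
by apply: rescaled_isometry => //; exact: (hg A FA).1.
Qed.

Lemma shift_isometry (v : E) : euclidean_isometry (fun x => x + v).
Proof. by move=> x y; rewrite opprD addrACA subrr addr0. Qed.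

Lemma rescalable_translated : rescalable translated_copies.
Proof.
move=> K F m _ _ PF; have /choice[v hv] : forall A, exists v : E,
    F A -> A = translate v K.
  move=> A; have [FA|nF] := pselect (F A); last by exists 0 => /nF.
  by have [v AE] := PF A FA; exists v.
exists (fun A x => x + v A) => [A FA|L s s0 _ [A FA <-]].
  by split; [exact: shift_isometry|exact: hv].
by exists (s *: v A); rewrite rescaled_shift ?gt_eqF.
Qed.

(** The lattice is scaled by [s]. Translation vectors are recovered uniquely from the copies by
    [translate_inj], so every scaled lattice vector occurs. *)
Lemma rescalable_lattice : rescalable lattice_translates.
Proof.
move=> K F m K0 Km [La [M Mu LaE] FE].
have /choice[v hv] : forall A, exists v : E, F A -> La v /\ A = translate v K.
  move=> A; have [FA|nF] := pselect (F A); last by exists 0 => /nF.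
  by move: FA; rewrite FE => -[v Lav AE]; exists v.
have vE w : La w -> v (translate w K) = w.
  move=> Law; have [|_ eqK] := hv (translate w K).
    by rewrite FE; exists w.
  by apply/esym; exact: translate_inj K0 Km eqK.
exists (fun A x => x + v A) => [A FA|L s s0].
  by split; [exact: shift_isometry|exact: (hv A FA).2].
exists [set s *: w | w in La].
  exists (s *: M); first by rewrite unitmxZ// unitfE gt_eqF.
  rewrite LaE; apply/seteqP; split=> [_ [_ [z _ <-] <-]|_ [z _ <-]].
    by exists z => //; rewrite scalemxAr.
  by exists (map_mx intr z *m M); [exists z|rewrite scalemxAr].
apply/seteqP; split=> [_ [A FA <-]|_ [_ [w Law <-] <-]].
  exists (s *: v A); first by exists (v A) => //; exact: (hv A FA).1.
  by rewrite rescaled_shift ?gt_eqF.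
exists (translate w K); first by rewrite FE; exists w.
by rewrite rescaled_shift ?gt_eqF// vE.
Qed.

Variables (P : set E -> set (set E) -> Prop) (K K0 : set E).
Hypotheses (hP : rescalable P).
Hypotheses (hK0 : convex_body_star K0) (hK : convex_body_star K).
Let lam := 1 + hausdorff_dist K K0.

Let lam_gt0 : 0 < lam.
Proof. by rewrite ltr_pwDl// hausdorff_dist_ge0. Qed.

Let K_K0 x : K x -> K0 (lam^-1 *: x).
Proof. exact: hausdorff_dist_scaled. Qed.

Let K0_K x : K0 x -> K (lam^-1 *: x).
Proof. by rewrite /lam hausdorff_distC; exact: hausdorff_dist_scaled. Qed.

(** The right side is an infimum, so each covering by copies of [K0] is rescaled by [lam^-1] into
    one by copies of [K]. *)
Lemma min_covering_density_le : (min_covering_density P K <=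
  (lam ^+ (2 * n))%:E * min_covering_density P K0)%E.
Proof.
rewrite -ereal_inf_pZl ?exprn_gt0//.
apply: le_ereal_inf_tmp => _ [_ [F [covF PF] <-] <-].
have [_ _ Kn] := hK; have [_ _ K0n] := hK0.
have [|g hg gP] := hP K0 F _ _ K0n PF; first by exists 0; exact: star0.
have [covF'] := rescaled_covering K K0 lam n%:R lam_gt0 (star0 _ hK)
  (star0 _ hK0) Kn K_K0 F g K0_K covF hg.
apply: le_trans; apply: ereal_inf_lbound; eexists; last by [].
by split=> //; apply: gP; rewrite invr_gt0.
Qed.

(** The left side is a supremum, so each packing by copies of [K] is rescaled by [lam] into one by
    copies of [K0]. *)
Lemma max_packing_density_le : (max_packing_density P K <=
  (lam ^+ (2 * n))%:E * max_packing_density P K0)%E.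
Proof.
apply: ge_ereal_sup => _ [F [packF PF] <-].
have [_ _ Kn] := hK; have [_ BK0 _] := hK0.
have [|g hg gP] := hP K F _ _ Kn PF; first by exists 0; exact: star0.
have [packF' le] := rescaled_packing K K0 lam n%:R lam_gt0 (star0 _ hK)
  (star0 _ hK0) Kn K_K0 F g K0_K BK0 packF hg.
apply: (le_trans le); rewrite lee_pmul2l ?lte_fin ?exprn_gt0//.
apply: ereal_sup_ubound; eexists; last by [].
by split=> //; exact: gP.
Qed.

End admissible_families.

Theorem theorem2 (R : realType) (n : nat) (hn : (0 < n)%N)
    (f : set 'rV[R]_n -> \bar R)
    (hf : [\/ f = theta_c, f = theta_t | f = theta_l] \/
          [\/ f = delta_c, f = delta_t | f = delta_l])
    (K0 : set 'rV[R]_n) (hK0 : convex_body_star K0)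
    (K : set 'rV[R]_n) (hK : convex_body_star K) :
  (f K <= ((1 + hausdorff_dist K K0) ^+ (2 * n))%:E * f K0)%E.
Proof.
have hc := @rescalable_congruent R n; have ht := @rescalable_translated R n.
have hl := @rescalable_lattice R n.
case: hf => -[] ->; try exact: min_covering_density_le.
all: exact: max_packing_density_le.
Qed.
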